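(* Let $n\ge 1$ and let $X_1,\dots,X_n$ be sets. Let $p\geq n$ and let $x_{i}=(x_{1}^{i},\ldots,x_{n}^{i})\in\mathbb{X}_{n}=X_1\times\cdots\times X_n$, $1\leq i\leq p$, be such that for every coordinate $j\in\{1,\dots,n\}$ the points $x_{j}^{1},\ldots,x_{j}^{p}$ of $X_j$ are pairwise distinct. Then the probability measure $P:=p^{-1}\sum_{i=1}^{p}\delta_{x_{i}}$ on $\mathbb{X}_n$ is marginally identifiable, i.e. the indexed family $(P_{\pi})_{\pi\in\Pi_{n}}$ is linearly independent.
   Context: $\Pi_n$ denotes the set of all partitions of $\{1,\dots,n\}$ into nonempty disjoint blocks. For a discrete probability measure $P$ on $\mathbb{X}_n=X_1\times\cdots\times X_n$ and $F\subseteq\{1,\dots,n\}$ nonempty, $P_F$ denotes the marginal of $P$ on $\prod_{i\in F}X_i$. For $\pi=(F_1,\dots,F_\ell)\in\Pi_n$, $P_\pi:=P_{F_1}\times\cdots\times P_{F_\ell}$ is the product of the marginals over the blocks of $\pi$, viewed as a measure on $\mathbb{X}_n$ (coordinates placed in their natural positions). Linear independence is over $\mathbb{R}$, in the vector space of discrete signed measures on $\mathbb{X}_n$. $\delta_x$ is the Dirac measure at $x$. *)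

(* Defs.v *)
From HB Require Import structures.
From mathcomp Require Import all_boot all_order all_algebra.
From mathcomp Require Import all_classical all_reals all_analysis.

Set Implicit Arguments.
Unset Strict Implicit.
Unset Printing Implicit Defensive.

Import Order.TTheory GRing.Theory Num.Theory.

Local Open Scope classical_set_scope.
Local Open Scope ring_scope.

(** * Discrete measurable spaces *)

(* [discrete T] is [T] with the sigma-algebra of all its subsets. *)
Definition discrete (T : Type) : Type := T.

HB.instance Definition _ (T : pointedType) := Pointed.on (discrete T).
HB.instance Definition _ (T : pointedType) :=
  @isMeasurable.Build default_measure_display (discrete T)
    discrete_measurable discrete_measurable0
    discrete_measurableC discrete_measurableU.

(** * Finite products *)

Section Products.
Context (n : nat) (X : 'I_n -> pointedType).

Definition prod_space : measurableType default_measure_display :=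
  discrete (forall i : 'I_n, X i).

(* Product of the [X i] over [i \in F] only. *)
Definition subprod_space (F : {set 'I_n}) :
    measurableType default_measure_display :=
  discrete (forall i : {i : 'I_n | i \in F}, X (val i)).

Definition restr (F : {set 'I_n}) (x : prod_space) : subprod_space F :=
  fun i => x (val i).

End Products.
Arguments restr {n X} F x.

(** * Marginals and their products *)

Definition set_partition (n : nat) : finType :=
  {Q : {set {set 'I_n}} | finset.partition Q [set: 'I_n]%SET}.

Section Marginals.
Context (R : realType) (n : nat) (X : 'I_n -> pointedType).
Local Open Scope ereal_scope.

Definition marginal (P : probability (prod_space X) R) (F : {set 'I_n}) :
    set (subprod_space X F) -> \bar R :=
  pushforward P (restr F).

(* A discrete measure is determined by its values on singletons, and a product
   of discrete measures gives a point the product of the masses of its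
   components.  Hence the product over the blocks [F] of [Q] of the marginals
   [marginal P F] gives [A] the (possibly uncountable, nonnegative) sum over
   [x \in A] of the products of the marginal masses of the restrictions of [x].
   Points keep their coordinates in their original positions, as the blocks
   only enter through [restr]. *)
Definition marginal_prod (P : probability (prod_space X) R)
    (Q : set_partition n) (A : set (prod_space X)) : \bar R :=
  \esum_(x in A) \prod_(F in val Q) marginal P [set restr F x].

Section MarginalProdMeasure.
Variables (P : probability (prod_space X) R) (Q : set_partition n).

Let mass_ge0 (x : prod_space X) :
  0 <= \prod_(F in val Q) marginal P [set restr F x].
Proof. by apply: prode_ge0 => F _; exact: measure_ge0. Qed.

Let marginal_prod0 : marginal_prod P Q set0 = 0.
Proof. exact: esum_set0. Qed.

Let marginal_prod_ge0 A : 0 <= marginal_prod P Q A.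
Proof. by apply: esum_ge0 => x _; exact: mass_ge0. Qed.

Let marginal_prod_semi_sigma_additive :
  semi_sigma_additive (marginal_prod P Q).
Proof.
move=> F _ tF _; rewrite /marginal_prod esum_bigcupT//.
rewrite -(@nneseries_esumT _ (fun i => marginal_prod P Q (F i)))//.
by apply: is_cvg_nneseries => i _ _; exact: marginal_prod_ge0.
Qed.

HB.instance Definition _ := isMeasure.Build _ _ _ (marginal_prod P Q)
  marginal_prod0 marginal_prod_ge0 marginal_prod_semi_sigma_additive.

End MarginalProdMeasure.
End Marginals.

(** * Marginal identifiability *)

Definition linearly_independent (K : nzRingType) (V : lmodType K)
    (I : finType) (v : I -> V) : Prop :=
  forall c : I -> K, \sum_(i : I) c i *: v i = 0 -> forall i, c i = 0.

(* The discrete signed measures on [prod_space X] form a subspace of the space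
   of all real set functions [set (prod_space X) -> R^o]; linear independence
   is computed there.  The measures involved are finite, so [fine] is the
   inclusion of their values into [R]. *)
Definition marginally_identifiable (R : realType) (n : nat)
    (X : 'I_n -> pointedType) (P : probability (prod_space X) R) : Prop :=
  linearly_independent (fun (Q : set_partition n) =>
    (fun A => fine (marginal_prod P Q A)) : set (prod_space X) -> R^o).

(** * Empirical measures *)

Section Empirical.
Context (R : realType) (d : measure_display) (T : measurableType d).
Local Open Scope ereal_scope.

(* The proof of [0 < p] is an argument so that this is a probability. *)
Definition empirical (p : nat) (p_gt0 : (0 < p)%N) (x : 'I_p -> T)
    (A : set T) : \bar R :=
  (p%:R^-1)%:E * \sum_(i < p) \d_(x i) A.

Variables (p : nat) (p_gt0 : (0 < p)%N) (x : 'I_p -> T).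

Let empirical0 : empirical p_gt0 x set0 = 0.
Proof. by rewrite /empirical big1 ?mule0// => i _; rewrite measure0. Qed.

Let empirical_ge0 A : 0 <= empirical p_gt0 x A.
Proof. by rewrite mule_ge0 ?sume_ge0// lee_fin invr_ge0. Qed.

Let empirical_semi_sigma_additive : semi_sigma_additive (empirical p_gt0 x).
Proof.
pose m : {measure set T -> \bar R}^nat := fun k =>
  if insub k is Some i then dirac (x i) else mzero.
have -> : empirical p_gt0 x =
    mscale (NngNum (ltac:(by rewrite invr_ge0) : (0 <= p%:R^-1 :> R)%R))
      (msum m p).
  apply/funext => A; rewrite /empirical /mscale /msum /=; congr (_ * _).
  by apply: eq_bigr => i _; rewrite /m valK.
exact: measure_semi_sigma_additive.
Qed.

HB.instance Definition _ := isMeasure.Build _ _ _ (empirical p_gt0 x)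
  empirical0 empirical_ge0 empirical_semi_sigma_additive.

Let empirical_setT : empirical p_gt0 x setT = 1.
Proof.
rewrite /empirical (eq_bigr (fun=> 1)) => [|i _]; last by rewrite diracT.
rewrite sumEFin big_const_ord iter_addr_0 -EFinM mulVf//.
by rewrite pnatr_eq0 -lt0n.
Qed.

HB.instance Definition _ := Measure_isProbability.Build _ _ _
  (empirical p_gt0 x) empirical_setT.

End Empirical.
Arguments empirical R {d T p} p_gt0 x A.

(* Main.v *)
Require Import Defs.
From mathcomp Require Import all_boot all_order all_algebra.
From mathcomp Require Import all_classical all_reals all_analysis.

(** Index by [f : 'I_n -> 'I_p] the points obtained by mixing coordinates of
    the sample: [mixed_point x f] takes its [j]-th coordinate from the sample
    point [f j].  Since the sample points are distinct in every coordinate,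
    the only sample point that can agree with [mixed_point x f] on a block [F]
    is the one whose index is the common value of [f] on [F].  So the block
    marginal gives the restricted point the mass [1/p] when [f] is constant on
    [F] and [0] otherwise ([marginal_empirical_mixed]), and [P_Q] charges
    [mixed_point x f] exactly when [f] is constant on every block of [Q], that
    is, when [Q] refines the partition of ['I_n] into the fibres of [f]
    ([marginal_prod_empirical_mixed]).

    Because [n <= p], every partition [Q] is the fibre partition of some [f]
    ([block_index]).  Evaluating the family [(P_Q)] at the corresponding points
    therefore gives a matrix with nonzero diagonal that is supported on the
    refinement order, i.e. a triangular one, and triangular families are
    linearly independent ([linearly_independent_triangular]).  Refinement is
    read off the equivalence relations: the size of the relation of being in
    the same block ([same_block_size]) strictly drops under proper refinement,
    and serves as the height in the triangular argument. *)

Set Implicit Arguments.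
Unset Strict Implicit.
Unset Printing Implicit Defensive.

Import Order.TTheory GRing.Theory Num.Theory.

Local Open Scope ring_scope.

(** If a relation had a nonzero coefficient, pick one of least height [h] and
    evaluate at its point: every other term vanishes, for lack of either the
    coefficient or the value. *)
Lemma linearly_independent_triangular (K : fieldType) (T : Type) (I : finType)
    (h : I -> nat) (v : I -> T -> K^o) (t : I -> T) :
  (forall i, v i (t i) != 0) ->
  (forall i j, v j (t i) != 0 -> j = i \/ (h j < h i)%N) ->
  linearly_independent (v : I -> (T -> K^o)).
Proof.
move=> diag upper c c0 i0; apply/eqP; apply: contraT => ci0.
case: (@arg_minnP _ i0 (fun i => c i != 0) h ci0) => i ci min_i.
have := congr1 (fun g : T -> K^o => g (t i)) c0.
rewrite fct_sumE (bigD1 i)//= big1 ?addr0 => [|j ji].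
  by move=> /eqP; rewrite /GRing.scale/= mulf_eq0 (negbTE ci) (negbTE (diag i)).
apply/eqP; rewrite /GRing.scale/= mulf_eq0; apply: contraT.
rewrite negb_or => /andP[cj /upper[/eqP|]]; first by rewrite (negbTE ji).
by rewrite ltnNge min_i.
Qed.

Section SetPartitions.
Variable n : nat.
Implicit Types Q : set_partition n.

Let cover_val Q : finset.cover (val Q) = [set: 'I_n]%SET.
Proof. exact: cover_partition (valP Q). Qed.

Let trivIset_val Q : finset.trivIset (val Q).
Proof. by case/and3P: (valP Q). Qed.

Lemma block_nonempty Q F : F \in val Q -> exists j, j \in F.
Proof.
case/and3P: (valP Q) => _ _ Q0 FQ; apply/finset.set0Pn.
by apply: contraNneq Q0 => <-.
Qed.

Definition constant_on (T : eqType) (f : 'I_n -> T) (F : {set 'I_n}) : bool :=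
  [forall j in F, forall k in F, f j == f k].

Definition constant_on_blocks (T : eqType) (f : 'I_n -> T) Q : bool :=
  [forall F in val Q, constant_on f F].

Definition same_block Q : {set 'I_n * 'I_n} :=
  finset.finset (fun jk => jk.2 \in finset.pblock (val Q) jk.1).

Definition same_block_size Q : nat := #|same_block Q|.

Lemma same_block_inj : injective same_block.
Proof.
move=> Q Q' eqQ; apply: val_inj.
rewrite -(equivalence_partition_pblock (valP Q)).
rewrite -(equivalence_partition_pblock (valP Q')).
congr (equivalence_partition _ _); apply/funext => j; apply/funext => k.
by have /setP/(_ (j, k)) := eqQ; rewrite !inE.
Qed.

(** A function into ['I_p] whose fibres are the blocks of [Q].  The element
    picked depends on the block alone, so it is the same for all coordinates in
    it; the default [j] is never taken, as [j] lies in its own block. *)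
Definition block_index p (n_le_p : (n <= p)%N) Q (j : 'I_n) : 'I_p :=
  widen_ord n_le_p (odflt j [pick k in finset.pblock (val Q) j]).

Lemma block_indexE p (n_le_p : (n <= p)%N) Q j k :
  (block_index n_le_p Q j == block_index n_le_p Q k) =
  (k \in finset.pblock (val Q) j).
Proof.
have inj_widen : injective (widen_ord n_le_p).
  by move=> a b /(congr1 val)/= /val_inj.
have memQ i : i \in finset.pblock (val Q) i by rewrite mem_pblock cover_val inE.
rewrite (inj_eq inj_widen) -eq_pblock ?cover_val ?inE//.
apply/eqP/eqP => [|eqjk]; last first.
  by rewrite eqjk; case: pickP => //= /(_ k); rewrite memQ.
case: pickP => [a aj|/(_ j)]; last by rewrite memQ.
case: pickP => [b bk|/(_ k)]; last by rewrite memQ.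
move=> /= ab; rewrite -(same_pblock (trivIset_val Q) aj).
by rewrite -(same_pblock (trivIset_val Q) bk) ab.
Qed.

Lemma block_index_constant p (n_le_p : (n <= p)%N) Q :
  constant_on_blocks (block_index n_le_p Q) Q.
Proof.
apply/forall_inP => F FQ; apply/forall_inP => j jF; apply/forall_inP => k kF.
by rewrite block_indexE (def_pblock (trivIset_val Q) FQ jF).
Qed.

(** Constancy of [block_index n_le_p Q] on the blocks of [Q'] says that [Q']
    refines [Q]; the relations are then nested, and equal only if the
    partitions are. *)
Lemma block_index_refine p (n_le_p : (n <= p)%N) Q Q' :
  constant_on_blocks (block_index n_le_p Q) Q' ->
  Q' = Q \/ (same_block_size Q' < same_block_size Q)%N.
Proof.
move=> cst; have sub : same_block Q' \subset same_block Q.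
  apply/fintype.subsetP => -[j k]; rewrite !inE/=.
  rewrite -(block_indexE n_le_p Q) => kj.
  have jQ' : j \in finset.cover (val Q') by rewrite cover_val inE.
  have /forall_inP/(_ j) := forall_inP cst _ (pblock_mem jQ').
  by rewrite mem_pblock => /(_ jQ') /forall_inP; exact.
have [eqQ|neqQ] := eqVneq Q' Q; [by left|right].
apply: proper_card; rewrite finset.properEneq sub andbT.
by apply: contra_neq neqQ; exact: same_block_inj.
Qed.

End SetPartitions.

Section EmpiricalMass.
Variables (R : realType) (n : nat) (X : 'I_n -> pointedType).
Variables (p : nat) (p_gt0 : (0 < p)%N) (x : 'I_p -> prod_space X).
Hypothesis x_inj : forall j : 'I_n, injective (fun i : 'I_p => x i j).
Implicit Types (f : 'I_n -> 'I_p) (F : {set 'I_n}) (Q : set_partition n).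

Definition mixed_point f : prod_space X := fun j => x (f j) j.

Lemma restr_mixed_point i f F :
  restr F (x i) = restr F (mixed_point f) <-> {in F, forall j, f j = i}.
Proof.
split=> [eqF j jF|fi].
  by have := congr1 (fun y => y (exist _ j jF)) eqF => /x_inj.
apply: functional_extensionality_dep => -[j jF].
by rewrite /restr /mixed_point /= fi.
Qed.

(** Only the sample point of index [f j] can have the given restriction. *)
Lemma marginal_empirical_mixed f F j : j \in F ->
  marginal (empirical R p_gt0 x) [set restr F (mixed_point f)]%classic =
  (p%:R^-1 *+ [forall k in F, f k == f j])%:E.
Proof.
move=> jF; rewrite -[LHS]/((p%:R^-1)%:E * \sum_(i < p) \d_(x i)
  (restr F @^-1` [set restr F (mixed_point f)])%classic)%E.
rewrite (bigD1 (f j))//= big1 => [|i ifj].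
  rewrite adde0 diracE -EFinM mulr_natr; congr (_ *+ _)%:E.
  congr nat_of_bool; apply/idP/forall_inP => [|fF]; rewrite inE/=.
    by move=> /restr_mixed_point fF k /fF ->.
  by apply/restr_mixed_point => k /fF/eqP.
rewrite diracE memNset//= => /restr_mixed_point/(_ j jF) fji.
by rewrite fji eqxx in ifj.
Qed.

Lemma marginal_prod_empirical_mixed f Q :
  (fine (marginal_prod (empirical R p_gt0 x) Q [set mixed_point f]%classic)
    != 0) = constant_on_blocks f Q.
Proof.
rewrite /marginal_prod esum_set1; last first.
  by apply: prode_ge0 => F _; exact: measure_ge0.
rewrite (eq_bigr (fun F => (p%:R^-1 *+ constant_on f F)%:E)) => [|F FQ].
  have mass_neq0 F : p%:R^-1 *+ constant_on f F != 0 :> R = constant_on f F.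
    by case: (constant_on f F); rewrite ?eqxx// mulr1n invr_eq0 pnatr_eq0 -lt0n.
  rewrite prodEFin/=; apply/prodf_neq0/forall_inP => cst F FQ.
    by rewrite -mass_neq0 cst.
  by rewrite mass_neq0 cst.
have [j jF] := block_nonempty FQ.
rewrite (marginal_empirical_mixed f jF); congr (_ *+ _)%:E; congr nat_of_bool.
apply/forall_inP/forall_inP => [cst i iF|cst i iF]; last first.
  by have /forall_inP := cst i iF; exact.
by apply/forall_inP => k kF; rewrite (eqP (cst i iF)) eq_sym cst.
Qed.

End EmpiricalMass.

Theorem lemma3p5 (R : realType) (n : nat) (n_ge1 : (1 <= n)%N)
    (X : 'I_n -> pointedType) (p : nat) (n_le_p : (n <= p)%N)
    (x : 'I_p -> prod_space X)
    (x_inj : forall j : 'I_n, injective (fun i : 'I_p => x i j)) :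
  marginally_identifiable (empirical R (leq_trans n_ge1 n_le_p) x).
Proof.
apply: (@linearly_independent_triangular R _ _ (@same_block_size n) _
  (fun Q => [set mixed_point x (block_index n_le_p Q)]%classic)) => [Q|Q Q'].
  by rewrite marginal_prod_empirical_mixed// block_index_constant.
by rewrite marginal_prod_empirical_mixed//; exact: block_index_refine.
Qed.
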